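(* For each integer $b\geq 2$, let $T_b(x)=\sum_{n=0}^\infty \frac{\phi(b^n x)}{b^n}$ for $x\in[0,1]$, where $\phi(x)=\mathrm{dist}(x,\mathbb{Z})$. Then the graph $\mathcal{G}T_b=\{(x,T_b(x)):x\in[0,1]\}\subset\mathbb{R}^2$ satisfies $$\dim_A\mathcal{G}T_b=1.$$
   Context: $\phi(x)=\mathrm{dist}(x,\mathbb{Z})$ is the distance from the real number $x$ to the nearest integer. Assouad dimension: for a bounded set $E\subset\mathbb{R}^d$ and $\delta>0$, let $N_\delta(E)$ be the least number of open sets of diameter at most $\delta$ needed to cover $E$. Let $B(x,\rho)$ be the closed ball with center $x$ and radius $\rho$. For bounded $F\subset\mathbb{R}^d$, $\dim_A F$ is the infimum of all $\alpha>0$ for which there is a constant $C>0$ such that $N_r(B(x,R)\cap F)\leq C(R/r)^\alpha$ for all $0<r<R$ and all $x\in F$. *)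

(* Defs.v *)
From HB Require Import structures.
From mathcomp Require Import all_boot all_order all_algebra.
From mathcomp Require Import all_classical all_reals all_analysis.
Set Implicit Arguments.
Unset Strict Implicit.
Unset Printing Implicit Defensive.
Import Order.TTheory GRing.Theory Num.Theory.
Import numFieldNormedType.Exports.
Local Open Scope classical_set_scope.
Local Open Scope ring_scope.

(* The norm on ['rV[R]_d] provided by the library is the sup norm, so the
   Euclidean distance is spelled out here.  Both induce the same topology, so
   [open] below has its usual meaning. *)
Definition edist2 (R : realType) (d : nat) (x y : 'rV[R]_d) : R :=
  Num.sqrt (\sum_(i < d) (x ord0 i - y ord0 i) ^+ 2).

Definition eball (R : realType) (d : nat) (x : 'rV[R]_d) (rho : R) :
    set 'rV[R]_d :=
  [set y | edist2 x y <= rho].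

(* Extended-real valued: [+oo] on unbounded sets (and [-oo] on the empty set,
   which therefore satisfies every upper bound on the diameter). *)
Definition ediam (R : realType) (d : nat) (A : set 'rV[R]_d) : \bar R :=
  ereal_sup [set e | exists x y, [/\ A x, A y & e = (edist2 x y)%:E]].

(* The infimum of a nonempty set of natural numbers is its least element; the
   value is [+oo] when there is no finite cover, which does not occur for a
   bounded [E] and [0 < delta]. *)
Definition covering_number (R : realType) (d : nat) (delta : R)
    (E : set 'rV[R]_d) : \bar R :=
  ereal_inf [set (k%:R)%:E | k in [set k : nat |
    exists U : 'I_k -> set 'rV[R]_d,
      (forall i, open (U i) /\ (ediam (U i) <= delta%:E)%E) /\
      E `<=` \bigcup_i U i]].

Definition assouad_dim (R : realType) (d : nat) (F : set 'rV[R]_d) : \bar R :=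
  ereal_inf [set alpha%:E | alpha in [set alpha : R |
    0 < alpha /\
    exists2 C : R, 0 < C &
      forall (r rho : R) (x : 'rV[R]_d), 0 < r -> r < rho -> F x ->
        (covering_number r (eball x rho `&` F)
           <= (C * (rho / r) `^ alpha)%:E)%E]].

Definition dist_int (R : realType) (x : R) : R :=
  inf [set `|x - m%:~R| | m in [set: int]].

(* For [2 <= b] the series converges, being dominated by a geometric one, so
   that [limn] is its sum. *)
Definition takagi (R : realType) (b : nat) (x : R) : R :=
  limn (series (fun n : nat => dist_int (b%:R ^+ n * x) / b%:R ^+ n)).

Definition graph01 (R : realType) (f : R -> R) : set 'rV[R]_2 :=
  [set \row_(i < 2) (if i == ord0 then x else f x) | x in `[0, 1]].

(* Main.v *)
Require Import Defs.
From HB Require Import structures.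
From mathcomp Require Import all_boot all_order all_algebra.
From mathcomp Require Import all_classical all_reals all_analysis.
From mathcomp Require Import ring lra zify.

(* On a cell [k h, (k+1) h], h = 1 / (2 b^n), the n-th partial sum of the Takagi
   series is affine, with some slope s; each further term is 1-Lipschitz and the
   tail after n + j terms is O(b^-(n+j)), so
     |T x - T y - s (x - y)| <= j |x - y| + O(b^-(n+j)) for x, y in the cell.
   A ball of radius rho ~ h meets boundedly many cells, and taking
   j ~ log (rho / r) each of them costs O(j rho / r) sets of diameter r, because
   either |s| <= j + 1 and the function has slope O(j) at scale r, or s is larger
   and the graph is Lipschitz over the vertical axis at scale r.  Since the bound
   (rho / r) log (rho / r) is O((rho / r)^(1+e)), the dimension is at most 1; it is
   at least 1 because the graph projects onto [0, 1]. *)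

Set Implicit Arguments.
Unset Strict Implicit.
Unset Printing Implicit Defensive.
Import Order.TTheory GRing.Theory Num.Theory.
Import numFieldNormedType.Exports.
Local Open Scope classical_set_scope.
Local Open Scope ring_scope.

(** * Distance to the nearest integer *)

Lemma dist_int_le (R : realType) (x : R) (m : int) : dist_int x <= `|x - m%:~R|.
Proof.
by apply: ge_inf; [exists 0 => _ [k _ <-]; exact: normr_ge0 | exists m].
Qed.

Lemma le_dist_int (R : realType) (x y : R) :
  (forall m : int, y <= `|x - m%:~R|) -> y <= dist_int x.
Proof.
by move=> ylb; apply: lb_le_inf => [|_ [m _ <-]//]; exists `|x - 0%:~R|; exists 0.
Qed.

Lemma dist_int_ge0 (R : realType) (x : R) : 0 <= dist_int x.
Proof. by apply: le_dist_int => m; exact: normr_ge0. Qed.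

Lemma dist_int_le1 (R : realType) (x : R) : dist_int x <= 1.
Proof.
apply: le_trans (dist_int_le x (Num.floor x)) _.
have /andP[] := floor_itv x; rewrite intrD => fx xf.
by rewrite ger0_norm; lra.
Qed.

Lemma dist_int_lip (R : realType) (x y : R) :
  `|dist_int x - dist_int y| <= `|x - y|.
Proof.
have H (u v : R) : dist_int u - `|u - v| <= dist_int v.
  apply: le_dist_int => m; rewrite lerBlDl.
  by rewrite (le_trans (dist_int_le u m))// ler_distD.
by rewrite ler_norml; have := H x y; have := H y x; rewrite (distrC y); lra.
Qed.

(** The parity of [l] decides: for [l = 2m] the integer [m] is nearest on the whole interval (slope
    1), for [l = 2m + 1] it is [m + 1] (slope -1). Any other integer is ruled out because none lies
    strictly between [m] and [m + 1]. *)
Lemma dist_int_affine (R : realType) (l : nat) : exists s c : R, forall x : R,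
  l%:R / 2 <= x <= l.+1%:R / 2 -> dist_int x = s * x + c.
Proof.
have int_cases (m : nat) (z : int) :
    z%:~R <= m%:R :> R \/ m%:R + 1 <= z%:~R :> R.
  case: (lerP z m) => zm; [left|right].
    by rewrite -(ler_int R) in zm.
  by move: zm; rewrite -lezD1 -(ler_int R) intrD.
have := odd_double_half l; set m := l./2; case: (odd l) => <-.
- exists (-1), (m%:R + 1) => x; rewrite -muln2 -(natr1 (_ + _)%N) !natrD natrM /= => /andP[xl xr].
  apply/eqP; rewrite eq_le; apply/andP; split.
    apply: le_trans (dist_int_le x m.+1) _.
    by rewrite ler_norml -pmulrn -natr1; lra.
  apply: le_dist_int => z.
  by rewrite leNgt ltr_norml; apply/negP; case: (int_cases m z); lra.
- exists 1, (- m%:R) => x; rewrite -muln2 -(natr1 (_ + _)%N) !natrD natrM /= => /andP[xl xr].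
  apply/eqP; rewrite eq_le; apply/andP; split.
    apply: le_trans (dist_int_le x m) _.
    by rewrite ler_norml -pmulrn; lra.
  apply: le_dist_int => z.
  by rewrite leNgt ltr_norml; apply/negP; case: (int_cases m z); lra.
Qed.

(** * Partial sums and tails of the Takagi series *)

Definition takagi_term (R : realType) (b : nat) (x : R) : R ^nat :=
  fun n => dist_int (b%:R ^+ n * x) / b%:R ^+ n.

Section Takagi.
Variables (R : realType) (b : nat).
Hypothesis hb : (2 <= b)%N.

Let b0 : 0 < b%:R :> R. Proof. by rewrite ltr0n; lia. Qed.
Let bX0 n : 0 < b%:R ^+ n :> R. Proof. by rewrite exprn_gt0. Qed.

Lemma takagi_term_ge0 (x : R) n : 0 <= takagi_term b x n.
Proof. by rewrite divr_ge0// ?dist_int_ge0// ltW. Qed.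

(** The dilation by [b ^ n] inside cancels the division by [b ^ n] outside, so the Lipschitz
    constant is 1 for every [n]. *)
Lemma takagi_term_lip (x y : R) n :
  `|takagi_term b x n - takagi_term b y n| <= `|x - y|.
Proof.
rewrite /takagi_term -mulrBl normrM [X in _ * X]gtr0_norm ?invr_gt0//.
rewrite ler_pdivrMr// (le_trans (dist_int_lip _ _))//.
by rewrite -mulrBr normrM gtr0_norm// mulrC.
Qed.

(** Multiplication by [b ^ i] sends the cell into the half-integer interval [[l/2, (l+1)/2]] with
    [l = k %/ b ^ (n - i)], where [dist_int] is affine. *)
Lemma takagi_term_affine n i k : (i <= n)%N -> exists s c : R, forall x : R,
  k%:R / (2 * b%:R ^+ n) <= x <= k.+1%:R / (2 * b%:R ^+ n) ->
  takagi_term b x i = s * x + c.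
Proof.
move=> ile.
have [s [c sc]] := dist_int_affine R (k %/ b ^ (n - i)).
exists s, (c / b%:R ^+ i) => x /andP[kx xk].
have ni : b%:R ^+ n = b%:R ^+ (n - i) * b%:R ^+ i :> R by rewrite -exprD subnK.
rewrite /takagi_term sc ?mulrDl; first by field; rewrite gt_eqF.
have bg : (0 < b ^ (n - i))%N by rewrite expn_gt0; lia.
have d0 : 0 < 2 * (b%:R ^+ (n - i) * b%:R ^+ i) :> R by rewrite !mulr_gt0.
move: kx xk; rewrite ni ler_pdivrMr// ler_pdivlMr//.
set y := b%:R ^+ i * x => kx xk.
have {}kx : k%:R <= 2 * y * b%:R ^+ (n - i) by rewrite (le_trans kx)// /y; lra.
have {}xk : 2 * y * b%:R ^+ (n - i) <= k.+1%:R by rewrite (le_trans _ xk)// /y; lra.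
have h1 : ((k %/ b ^ (n - i)) * b ^ (n - i) <= k)%N by exact: leq_trunc_div.
have h2 : (k.+1 <= (k %/ b ^ (n - i)).+1 * b ^ (n - i))%N by exact: ltn_ceil.
move: h1 h2; rewrite -(ler_nat R) -[(_ <= _ * _)%N](ler_nat R) !natrM !natrX.
move=> /le_trans/(_ kx); rewrite ler_pM2r// => h1.
move=> /(le_trans xk); rewrite ler_pM2r// => h2.
by apply/andP; split; lra.
Qed.

Lemma takagi_partial_affine n m k : (m <= n.+1)%N -> exists s c : R, forall x : R,
  k%:R / (2 * b%:R ^+ n) <= x <= k.+1%:R / (2 * b%:R ^+ n) ->
  series (takagi_term b x) m = s * x + c.
Proof.
elim: m => [_|m IH mn].
  by exists 0, 0 => x _; rewrite seriesEnat/= big_geq// mul0r addr0.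
have [s [c sc]] := IH (ltnW mn).
have [s' [c' sc']] := @takagi_term_affine n m k mn.
exists (s + s'), (c + c') => x xk.
by rewrite seriesSr sc// sc'//; ring.
Qed.

Lemma takagi_partial_lip (x y : R) m j :
  `|series (takagi_term b x) (m + j)%N - series (takagi_term b y) (m + j)%N
   - (series (takagi_term b x) m - series (takagi_term b y) m)| <= j%:R * `|x - y|.
Proof.
elim: j => [|j IH]; first by rewrite addn0 subrr normr0 mul0r.
rewrite addnS !seriesSr -natr1 mulrDl mul1r.
have := takagi_term_lip x y (m + j)%N; move: IH.
set P := series _ _; set Q := series _ _; set P' := series _ _; set Q' := series _ _.
move=> IH L.
apply: le_trans (lerD IH L); apply: le_trans (ler_normD _ _).
by rewrite le_eqVlt; apply/orP; left; apply/eqP; congr (`| _ |); ring.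
Qed.

(** The partial sums increase, while adding [2 / b ^ m] to them gives a decreasing sequence: the
    next term is at most [1 / b ^ m], and [2 <= b] at least halves the correction. The limit is
    caught between the two. *)
Lemma takagi_partial_le (x : R) m :
  series (takagi_term b x) m <= takagi b x <= series (takagi_term b x) m + 2 / b%:R ^+ m.
Proof.
pose S := series (takagi_term b x).
have nd : {homo S : n m / (n <= m)%N >-> n <= m}.
  by apply/nondecreasing_seqP => n; rewrite /S seriesSr lerDl takagi_term_ge0.
have ni : {homo (fun n => S n + 2 / b%:R ^+ n) : n m / (n <= m)%N >-> m <= n}.
  apply/nonincreasing_seqP => n; rewrite /S seriesSr.
  have : takagi_term b x n <= 1 / b%:R ^+ n.
    by rewrite ler_pM2r ?invr_gt0// dist_int_le1.
  have : (b%:R ^+ n.+1)^-1 <= (b%:R ^+ n)^-1 / 2 :> R.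
    rewrite exprS invfM mulrC ler_pM2l ?invr_gt0// lef_pV2 ?posrE//.
    by rewrite ler_nat.
  lra.
(* [takagi] is a [limn], so convergence must be known before the limit can be compared with the
   partial sums. *)
have cv : cvgn S.
  apply: nondecreasing_is_cvgn => //; exists (S 0%N + 2 / b%:R ^+ 0) => _ [n _ <-].
  apply: le_trans (ni 0%N n isT).
  by rewrite lerDl divr_ge0// ltW.
apply/andP; split; first exact: nondecreasing_cvgn_le.
apply: limr_le => //; near=> n.
apply: le_trans (ni m n _); first by rewrite lerDl divr_ge0// ltW.
by near: n; exists m.
Unshelve. all: by end_near. Qed.

Lemma takagi_ge0 (x : R) : 0 <= takagi b x.
Proof.
by have /andP[+ _] := takagi_partial_le x 0; rewrite seriesEnat/= big_geq.
Qed.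

Lemma takagi_le2 (x : R) : takagi b x <= 2.
Proof.
have /andP[_] := takagi_partial_le x 0.
by rewrite seriesEnat/= big_geq// expr0 add0r divr1.
Qed.

Lemma takagi_almost_affine n k : exists s : R, forall (j : nat) (x y : R),
  k%:R / (2 * b%:R ^+ n) <= x <= k.+1%:R / (2 * b%:R ^+ n) ->
  k%:R / (2 * b%:R ^+ n) <= y <= k.+1%:R / (2 * b%:R ^+ n) ->
  `|takagi b x - takagi b y - s * (x - y)| <= j%:R * `|x - y| + 2 / b%:R ^+ (n + j).
Proof.
have [s [c sc]] := @takagi_partial_affine n n k (leqnSn n).
exists s => j x y xk yk.
have := takagi_partial_lip x y n j; rewrite sc// sc//.
(* Both tails lie in [[0, 2 / b ^ (n + j)]], so their difference costs this amount only once; the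
   constant [c] cancels. *)
have := takagi_partial_le x (n + j)%N; have := takagi_partial_le y (n + j)%N.
set e := 2 / _; set d := _ * `|_|; rewrite !ler_norml; lra.
Qed.

End Takagi.

(** * Counting covers by small open sets *)

Definition coverable (R : realType) (d : nat) (r : R) (E : set 'rV[R]_d)
    (k : nat) : Prop :=
  exists U : 'I_k -> set 'rV[R]_d,
    (forall i, open (U i) /\ (ediam (U i) <= r%:E)%E) /\ E `<=` \bigcup_i U i.

Section Coverable.
Variables (R : realType) (d : nat) (r : R).
Implicit Types (E F : set 'rV[R]_d).

Lemma covering_number_le E k :
  coverable r E k -> (covering_number r E <= (k%:R)%:E)%E.
Proof. by move=> Ek; apply: ereal_inf_lbound; exists k. Qed.

Lemma coverableS E F k : E `<=` F -> coverable r F k -> coverable r E k.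
Proof. by move=> EF [U [Uo FU]]; exists U; split => // y /EF/FU. Qed.

Lemma coverable0 k : coverable r (set0 : set 'rV[R]_d) k.
Proof.
exists (fun=> set0); split => // _; split; first exact: open0.
by apply/ereal_supP => e [x [y []]].
Qed.

Lemma coverableU E F k l :
  coverable r E k -> coverable r F l -> coverable r (E `|` F) (k + l)%N.
Proof.
move=> [U [Uo EU]] [V [Vo FV]].
exists (fun i : 'I_(k + l) => match fintype.split i with inl u => U u | inr v => V v end); split.
  by move=> i; case: (fintype.split i).
move=> y [/EU[u _ Uy]|/FV[v _ Vy]].
- exists (lshift l u) => //; case: splitP => [u' /= uu'|v' /= uv'].
    by rewrite -(val_inj uu' : u = u').
  by have := ltn_ord u; rewrite uv' ltnNge leq_addr.
- exists (rshift k v) => //; case: splitP => [u' /= uu'|v' /= /addnI vv'].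
    by have := ltn_ord u'; rewrite -uu' ltnNge leq_addr.
  by rewrite -(val_inj vv' : v = v').
Qed.

Lemma coverableW E k l : (k <= l)%N -> coverable r E k -> coverable r E l.
Proof.
move=> kl Ek; rewrite -(subnKC kl); apply: coverableS (coverableU Ek (coverable0 _)).
by move=> y Ey; left.
Qed.

(** Induction on [K], peeling off the last slab. It serves to cut along either coordinate axis; the
    slabs are closed so that they can be the closed cells on which the Takagi function is almost
    affine. *)
Lemma coverable_slices E (p : 'rV[R]_d -> R) (A w : R) K M : 0 < w ->
  (forall y, E y -> A <= p y < A + K%:R * w) ->
  (forall i : nat, coverable r
     (E `&` [set y | A + i%:R * w <= p y <= A + i.+1%:R * w]) M) ->
  coverable r E (K * M)%N.
Proof.
move=> w0; elim: K E => [|K IH] E Eb Es.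
  apply: coverableS (coverable0 _) => y /Eb; rewrite mul0r addr0 => /andP[].
  by move=> /le_lt_trans/[apply]; rewrite ltxx.
rewrite mulSn addnC.
pose E1 := E `&` [set y | p y < A + K%:R * w].
apply: (coverableS (F := E1 `|` (E `&`
    [set y | A + K%:R * w <= p y <= A + K.+1%:R * w]))).
  move=> y Ey; have /andP[pl pu] := Eb y Ey.
  case: (ltP (p y) (A + K%:R * w)) => py; [by left|right].
  by split => //=; rewrite py ltW.
apply: coverableU (Es K); apply: IH => [y [Ey /= pu]|i].
  by have /andP[-> _] := Eb y Ey.
by apply: coverableS (Es i) => y [[Ey _] ?]; split.
Qed.

Lemma edist2_coord (x y : 'rV[R]_d) (i : 'I_d) :
  `|x ord0 i - y ord0 i| <= edist2 x y.
Proof.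
rewrite -sqrtr_sqr ler_wsqrtr// (bigD1 i)//= lerDl.
by apply: sumr_ge0 => k _; exact: sqr_ge0.
Qed.

End Coverable.

Lemma ord2P (i : 'I_2) : i = ord0 \/ i = ord_max.
Proof. by case: i => [[|[|//]] ?]; [left|right]; apply: val_inj. Qed.

(** The rational 3/2 stands in for the square root of 2. *)
Lemma edist2_le (R : realType) (x y : 'rV[R]_2) (a : R) :
  (forall i, `|x ord0 i - y ord0 i| <= a) -> edist2 x y <= 3 / 2 * a.
Proof.
move=> xy.
have a0 : 0 <= a by apply: le_trans (xy ord0).
have s0 : 0 <= 3 / 2 * a by lra.
rewrite -(ger0_norm s0) -sqrtr_sqr ler_wsqrtr//.
apply: (@le_trans _ _ (\sum_(i < 2) a ^+ 2)).
  by apply: ler_sum => i _; rewrite -real_normK ?num_real// lerXn2r ?nnegrE.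
rewrite sumr_const card_ord; nra.
Qed.

(** One open sup-norm ball of radius [3 * w] about a point of [E] suffices: its coordinate widths
    are at most [6 * w], hence its Euclidean diameter at most [9 * w]. *)
Lemma coverable1 (R : realType) (r w : R) (E : set 'rV[R]_2) :
  0 < w -> 9 * w <= r ->
  (forall y z, E y -> E z -> forall i, `|y ord0 i - z ord0 i| <= 2 * w) ->
  coverable r E 1.
Proof.
move=> w0 wr Ew.
have [->|/set0P[z Ez]] := eqVneq E set0; first exact: coverable0.
exists (fun=> ball z (3 * w)); split => [_|y Ey]; last first.
  exists ord0 => //; split; first by lra.
  move=> i j; rewrite [i]ord1 /ball/=.
  by have := Ew z y Ez Ey j; lra.
split; first exact: ball_open.
apply/ereal_supP => _ [x [y [[_ zx] [_ zy] ->]]]; rewrite lee_fin.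
apply: le_trans (_ : 3 / 2 * (6 * w) <= _); last by lra.
apply: edist2_le => i.
have := zx ord0 i; have := zy ord0 i; rewrite /ball/= !ltr_norml ler_norml; lra.
Qed.

(** Supplies the depth [j]: the least power of 2 above [36 * t] is at most [72 * t], so [j] is
    logarithmic in [t] and thus dominated by any positive power of [t]. *)
Lemma log_le_powR (R : realType) (e : R) : 0 < e -> exists2 D : R, 0 < D &
  forall t : R, 1 < t -> exists j : nat,
    36 * t <= 2 ^+ j /\ j%:R + 1 <= D * t `^ e.
Proof.
move=> e0.
have ln2 : 0 < ln 2 :> R by rewrite ln_gt0// ltr1n.
have ln72 : 0 < ln 72 :> R by rewrite ln_gt0// ltr1n.
exists (1 + ln 72 / ln 2 + 1 / (e * ln 2)).
  by rewrite !addr_gt0// divr_gt0// mulr_gt0.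
move=> t t1; have t0 : 0 < t by lra.
pose N := (Num.truncn (36 * t)).+1.
have t36 : (Num.truncn (36 * t))%:R <= 36 * t by rewrite truncn_le; lra.
have N1 : (1 < N)%N by rewrite /N ltnS truncn_gt0; lra.
have /andP[jN Nj] := up_log_bounds (isT : 1 < 2)%N N1.
exists (up_log 2 N); set j := up_log 2 N; split.
  rewrite (le_trans (ltW (truncnS_gt _)))// -/N.
  by rewrite -(ler_nat R) natrX in Nj.
have j0 : (0 < j)%N by rewrite up_log_gt0.
have jt : 2 ^+ j <= 72 * t.
  move: jN; rewrite /N ltnS -(ler_nat R) natrX => /le_trans/(_ t36).
  by rewrite -/j -{2}(prednK j0) exprS; lra.
have te1 : 1 <= t `^ e by rewrite -(powRr0 t) ler_powR ?ltW.
have lnt : ln t <= t `^ e / e.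
  rewrite ler_pdivlMr// mulrC -ln_powR ltW// ln_sublinear//; lra.
have jle : j%:R <= (ln 72 + ln t) / ln 2.
  rewrite ler_pdivlMr//.
  have : ln (2 ^+ j) <= ln (72 * t).
    by rewrite ler_ln ?posrE ?exprn_gt0// mulr_gt0.
  by rewrite lnXn// lnM ?posrE// mulr_natl.
have : (ln 72 + ln t) / ln 2 <= (ln 72 * t `^ e + t `^ e / e) / ln 2.
  by rewrite ler_pM2r ?invr_gt0// lerD// ler_peMr// ltW.
move=> /(le_trans jle) jle2; apply: (le_trans (lerD jle2 te1)).
rewrite le_eqVlt; apply/orP; left; apply/eqP.
by field; rewrite !gt_eqF.
Qed.

(** * Upper bound: covering a ball of the graph *)

Section UpperBound.
Variables (R : realType) (b : nat).
Hypothesis hb : (2 <= b)%N.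

Let b0 : 0 < b%:R :> R. Proof. by rewrite ltr0n; lia. Qed.
Let bX0 n : 0 < b%:R ^+ n :> R. Proof. by rewrite exprn_gt0. Qed.

Lemma coverable_cell (n k j : nat) (c rho r w : R) (E : set 'rV[R]_2) :
  0 < rho -> 0 < w -> 9 * w <= r ->
  2 / b%:R ^+ (n + j) <= w -> 1 / (2 * b%:R ^+ n) <= rho ->
  (forall y, E y -> [/\ k%:R / (2 * b%:R ^+ n) <= y ord0 ord0
                        <= k.+1%:R / (2 * b%:R ^+ n),
     y ord0 ord_max = takagi b (y ord0 ord0) & `|y ord0 ord_max - c| <= rho]) ->
  coverable r E ((Num.truncn (2 * rho / w)).+1 * (4 * j + 5)).
Proof.
move=> rho0 w0 wr ew hrho EP.
have [s sP] := @takagi_almost_affine R b hb n k.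
have KP : 2 * rho < (Num.truncn (2 * rho / w)).+1%:R * w.
  by rewrite -ltr_pdivrMr// truncnS_gt.
have main (y z : 'rV[R]_2) : E y -> E z ->
    `|y ord0 ord_max - z ord0 ord_max - s * (y ord0 ord0 - z ord0 ord0)|
    <= j%:R * `|y ord0 ord0 - z ord0 ord0| + w.
  move=> /EP[yk -> _] /EP[zk -> _].
  by apply: le_trans (sP j _ _ yk zk) _; rewrite lerD2l.
have [sj|sj] := lerP `|s| (j%:R + 1).
(* Moderate slope: columns of width [w] over the cell, whose length is at most [rho]. *)
- apply: (coverable_slices (p := fun y => y ord0 ord0)
      (A := k%:R / (2 * b%:R ^+ n)) w0).
    move=> y /EP[/andP[-> yk] _ _] /=.
    by apply: le_lt_trans yk _; rewrite -natr1 mulrDl ltrD2l; lra.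
  move=> i; set A := _ / _; set E' := E `&` _.
  have [->|/set0P[z [Ez /andP[zl zu]]]] := eqVneq E' set0; first exact: coverable0.
  (* In a column heights differ from that of [z] by at most [(j + 1) w + j w + w = (2 j + 2) w], a
     range of length [(4 j + 4) w]; one more box makes the upper bound strict. *)
  rewrite -[(4 * j + 5)%N]muln1.
  apply: (coverable_slices (p := fun y => y ord0 ord_max)
      (A := z ord0 ord_max - (2 * j%:R + 2) * w) w0).
    move=> y [Ey /andP[yl yu]] /=.
    move: (main y z Ey Ez) zl zu yl yu; rewrite -natr1 natrD natrM.
    set dx := y ord0 ord0 - z ord0 ord0 => dy zl zu yl yu.
    have dxw : `|dx| <= w by rewrite ler_norml /dx; lra.
    have sdx : `|s * dx| <= (j%:R + 1) * w by rewrite normrM ler_pM.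
    have jdx : j%:R * `|dx| <= j%:R * w by rewrite ler_wpM2l.
    by move: dy sdx; rewrite !ler_norml; lra.
  move=> l; apply: (coverable1 w0 wr) => y y' [[Ey /andP[yl yu]] /andP[yl' yu']].
  move=> [[Ey' /andP[zl' zu']] /andP[zl2 zu2]] u.
  move: yl yu yl' yu' zl' zu' zl2 zu2; rewrite -!natr1 => *.
  by case: (ord2P u) => ->; rewrite ler_norml; lra.
(* Steep slope: horizontal strips of height [w] across the window of height [2 * rho], one set for
   each. *)
- apply: (@coverableW _ _ _ _ ((Num.truncn (2 * rho / w)).+1 * 1)).
    by rewrite leq_mul2l; lia.
  apply: (coverable_slices (p := fun y => y ord0 ord_max) (A := c - rho) w0).
    by move=> y /EP[_ _]; rewrite ler_norml; lra.
  move=> l; apply: (coverable1 w0 wr) => y y' [Ey /andP[yl yu]].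
  move=> [Ey' /andP[yl' yu']] u.
  move: yl yu yl' yu' (main y y' Ey Ey'); rewrite -!natr1.
  set dx := y ord0 ord0 - y' ord0 ord0; set dy := y ord0 ord_max - _.
  move=> yl yu yl' yu' dxy.
  have dyw : `|dy| <= w by rewrite ler_norml /dy; lra.
  case: (ord2P u) => ->; last by rewrite -/dy; lra.
  (* Since [j + 1 < |s|], this leaves [|dx| <= |dy| + w <= 2 * w]. *)
  have : `|s| * `|dx| <= `|dy| + (j%:R * `|dx| + w).
    rewrite -normrM; apply: le_trans (lerD (lexx _) dxy).
    by have := ler_normB dy (dy - s * dx); rewrite subKr.
  have : (j%:R + 1) * `|dx| <= `|s| * `|dx| by rewrite ler_wpM2r// ltW.
  lra.
Qed.

(** The least [n] whose cell length [h] is at most [rho] also has [rho < b * h], by minimality, if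
    [n > 0]. For [n = 0] there is no coarser grid, but [b * h = b / 2] is already at least the
    length of [[0, 1]]; hence the bound on [|x - y|] rather than on [rho]. *)
Lemma grid_scale (rho : R) : 0 < rho -> exists n,
  1 / (2 * b%:R ^+ n) <= rho /\
  forall x y : R, 0 <= x <= 1 -> 0 <= y <= 1 -> `|x - y| <= rho ->
    `|x - y| <= b%:R * (1 / (2 * b%:R ^+ n)).
Proof.
move=> rho0.
have ex : exists n, 1 / (2 * b%:R ^+ n) <= rho.
  pose n := (Num.truncn (1 / rho)).+1; exists n.
  rewrite ler_pdivrMr ?mulr_gt0// -ler_pdivrMl// mulrC.
  apply: (le_trans (ltW (truncnS_gt _))); rewrite -/n.
  have : (n <= b ^ n)%N by rewrite ltnW// ltn_expl.
  rewrite -(ler_nat R) natrX => /le_trans; apply.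
  by have := bX0 n; lra.
case: (ex_minnP ex) => n hn nmin; exists n; split => // x y x01 y01.
case: n hn nmin => [|n] hn nmin xy.
  have b2 : 2 <= b%:R :> R by rewrite ler_nat.
  rewrite expr0 mulr1; apply: (@le_trans _ _ 1); last by lra.
  by rewrite ler_norml; lra.
apply: le_trans xy _; rewrite exprS.
have -> : b%:R * (1 / (2 * (b%:R * b%:R ^+ n))) = 1 / (2 * b%:R ^+ n) :> R.
  by field; rewrite !gt_eqF.
by rewrite leNgt; apply/negP => /ltW/nmin; rewrite ltnn.
Qed.

Lemma graph01P (f : R -> R) (y : 'rV[R]_2) : graph01 f y ->
  0 <= y ord0 ord0 <= 1 /\ y ord0 ord_max = f (y ord0 ord0).
Proof. by move=> [x /= + <-]; rewrite in_itv/= !mxE/=. Qed.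

Lemma coverable_takagi_ball (r rho : R) (x : 'rV[R]_2) (j : nat) :
  0 < r -> 0 < rho -> graph01 (takagi b) x -> 36 * rho <= r * 2 ^+ j ->
  coverable r (eball x rho `&` graph01 (takagi b))
    ((2 * b + 2) * ((Num.truncn (18 * rho / r)).+1 * (4 * j + 5))).
Proof.
move=> r0 rho0 /graph01P[x01 xT] rj.
have [n [hn hb']] := grid_scale rho0; set h := 1 / (2 * b%:R ^+ n) in hn hb'.
have h0 : 0 < h by rewrite divr_gt0// mulr_gt0.
have /andP[x0 x1] := x01.
have := truncn_itv (divr_ge0 x0 (ltW h0)); set q := Num.truncn _.
rewrite ler_pdivlMr// ltr_pdivrMr// -natr1 => /andP[qx xq].
(* The cells start [b] places left of the cell [q] of [x]. Natural subtraction truncates at 0,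
   harmlessly, since abscissas on the graph are nonnegative. *)
have [qb1 qb2] : ((q - b)%:R <= 0 :> R \/ (q - b)%:R <= q%:R - b%:R :> R) /\
    q%:R - b%:R <= (q - b)%:R :> R.
  have [qb|/ltnW bq] := leqP q b.
    move: (qb); rewrite -subn_eq0 => /eqP ->.
    by split; [left|rewrite -(ler_nat R) in qb; lra].
  by rewrite natrB//; split; [right|].
apply: (coverable_slices (p := fun y => y ord0 ord0)
  (A := (q - b)%:R * h) h0) => [y|i].
  move=> [/= yx /graph01P[y01 _]].
  have := hb' _ _ x01 y01 (le_trans (edist2_coord x y ord0) yx).
  have /andP[y0 y1] := y01.
  rewrite ler_norml natrD natrM => /andP[l1 l2].
  apply/andP; split.
    case: qb1 => qb1; first by apply: le_trans y0; rewrite pmulr_lle0.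
    have := ler_wpM2r (ltW h0) qb1; lra.
  have := ler_wpM2r (ltW h0) qb2; lra.
(* The mesh is [w = r / 9], as [coverable1] demands. *)
have -> : 18 * rho / r = 2 * rho / (r / 9) by field; rewrite gt_eqF.
apply: (@coverable_cell n (q - b + i)%N j (x ord0 ord_max)) => //.
- lra.
- lra.
(* The tail is [4 * h / b ^ j <= 4 * rho / 2 ^ j <= r / 9]; this is the origin of the factor 36. *)
- apply: (@le_trans _ _ (4 * rho / 2 ^+ j)); last first.
    by rewrite ler_pdivrMr ?exprn_gt0//; lra.
  have -> : 2 / b%:R ^+ (n + j) = 4 * h / b%:R ^+ j :> R.
    by rewrite exprD /h; field; rewrite !gt_eqF.
  apply: ler_pM; rewrite ?invr_ge0 ?(ltW (bX0 _))//; try lra.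
  by rewrite lef_pV2 ?posrE ?exprn_gt0// lerXn2r ?nnegrE// ler_nat.
- move=> y [[/= yx /graph01P[y01 yT]] /andP[yl yu]]; split => //; last first.
    by rewrite distrC (le_trans (edist2_coord _ _ _) yx).
  rewrite -addnS !natrD; move: yl yu; rewrite /h !mul1r -!mulrDl.
  by move=> -> ->.
Qed.

Lemma takagi_assouad_le1 : (assouad_dim (graph01 (takagi b)) <= (1 : R)%:E)%E.
Proof.
apply/lee_addgt0Pr => e e0; rewrite -EFinD.
apply: ereal_inf_lbound; exists (1 + e) => //; split; first lra.
have [D D0 jP] := log_le_powR e0.
exists ((2 * b + 2)%:R * (19 * (5 * D))).
  by rewrite !mulr_gt0// ltr0n addn2.
move=> r rho x r0 rrho Fx.
have rho0 : 0 < rho by exact: lt_trans rrho.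
set t := rho / r.
have t1 : 1 < t by rewrite /t ltr_pdivlMr// mul1r.
have t0 : 0 < t by lra.
have [j [tj jD]] := jP t t1.
have rj : 36 * rho <= r * 2 ^+ j.
  by move: tj; rewrite /t mulrA ler_pdivrMr// [_ * r]mulrC.
apply: le_trans (covering_number_le (coverable_takagi_ball r0 rho0 Fx rj)) _.
rewrite lee_fin natrM -[leRHS]mulrA ler_wpM2l// natrM.
have tN0 : t != 0 by rewrite gt_eqF.
rewrite powRD ?tN0 ?implybT// powRr1 ?(ltW t0)//.
have -> : 19 * (5 * D) * (t * t `^ e) = (19 * t) * (5 * (D * t `^ e)) by ring.
apply: ler_pM => //.
  rewrite -natr1 -mulrA -/t.
  have : (Num.truncn (18 * t))%:R <= 18 * t by rewrite truncn_le; lra.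
  lra.
by rewrite natrD natrM; have := ler0n R j; lra.
Qed.

End UpperBound.

(** * Lower bound: separated points on the graph *)

Lemma covering_number_ge (R : realType) (d K : nat) (r : R) (E : set 'rV[R]_d)
    (p : 'I_K -> 'rV[R]_d) :
  (forall i, E (p i)) -> (forall i j, i != j -> r < edist2 (p i) (p j)) ->
  ((K%:R)%:E <= covering_number r E)%E.
Proof.
move=> Ep psep; apply/ereal_infP => _ [k [U [Ur EU]] <-]; rewrite lee_fin ler_nat.
have /choice[f fP] : forall i, exists u, U u (p i).
  by move=> i; have [u _ Uu] := EU _ (Ep i); exists u.
(* Pigeonhole: two of the points in one set would be at distance at most [r]. *)
suff /leq_card : injective f by rewrite !card_ord.
move=> i j fij; apply/eqP/negPn/negP => /psep; apply/negP; rewrite -leNgt -lee_fin.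
have [_ /ereal_supP] := Ur (f i); apply; exists (p i), (p j).
by split => //; rewrite fij.
Qed.

(** A fixed ball contains [n + 2] graph points over equally spaced abscissas, with gaps
    [1 / (n + 1)] exceeding [r = 1 / (n + 2)]. An admissible exponent [a] then satisfies
    [n + 2 <= C (rho (n + 2)) ^ a] for all [n], which fails for large [n] if [a < 1]. *)
Lemma assouad_dim_graph_ge1 (R : realType) (f : R -> R) (M : R) :
  (forall x, 0 <= f x <= M) -> (1%:E <= assouad_dim (graph01 f))%E.
Proof.
move=> f0M; apply/ereal_infP => _ [a [a0 [C C0 HC]] <-]; rewrite lee_fin.
rewrite leNgt; apply/negP => a1.
pose pt (x : R) : 'rV[R]_2 := \row_(i < 2) (if i == ord0 then x else f x).
have ptG (x : R) : 0 <= x <= 1 -> graph01 f (pt x).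
  by move=> x01; exists x => //=; rewrite in_itv.
have M0 : 0 <= M by have /andP[/le_trans] := f0M 0; apply.
(* Large enough for the ball about [pt 0] to contain the whole graph. *)
pose rho := 2 * (1 + M).
have rho0 : 0 < rho by rewrite /rho; lra.
have Kle (n : nat) : n.+2%:R <= C * (rho * n.+2%:R) `^ a :> R.
  have n0 : 0 < n.+1%:R :> R by rewrite ltr0n.
  have n1 : 0 < n.+2%:R :> R by rewrite ltr0n.
  have r0 : 0 < n.+2%:R^-1 :> R by rewrite invr_gt0.
  rewrite -lee_fin -{2}[n.+2%:R]invrK.
  have r1 : n.+2%:R^-1 < rho.
    by rewrite (@le_lt_trans _ _ 1)%R ?invf_le1 ?ler1n// /rho; lra.
  apply: le_trans (HC _ _ _ r0 r1 (ptG 0 _)); last by rewrite lexx ler01.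
  apply: (covering_number_ge (p := fun i : 'I_n.+2 => pt (i%:R / n.+1%:R))) => [i|i j ij].
    have i01 : 0 <= (i%:R / n.+1%:R : R) <= 1.
      rewrite divr_ge0//= ler_pdivrMr// mul1r ler_nat.
      by have := ltn_ord i; rewrite ltnS.
    split; last exact: ptG.
    apply: le_trans (edist2_le (a := 1 + M) _) _; last by rewrite /rho; lra.
    move=> u; rewrite !mxE; move: (i%:R / n.+1%:R) i01 => q q01.
    rewrite ler_norml; case: ifP => _; first lra.
    by have := f0M 0; have := f0M q; lra.
  apply: lt_le_trans (edist2_coord _ _ ord0).
  rewrite !mxE /= -mulrBl normrM [X in _ * X]gtr0_norm ?invr_gt0//.
  apply: (@lt_le_trans _ _ n.+1%:R^-1).
    by rewrite ltf_pV2 ?posrE// ltr_nat.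
  rewrite ler_peMl ?invr_ge0 ?(ltW n0)//.
  have [ij'|ij'|/val_inj ij'] := ltngtP i j.
  - move: ij'; rewrite -(ler_nat R) -natr1 ler_normr; lra.
  - move: ij'; rewrite -(ler_nat R) -natr1 ler_normr; lra.
  - by rewrite ij' eqxx in ij.
pose D := C * rho `^ a.
have D0 : 0 < D by rewrite mulr_gt0// powR_gt0.
(* Chosen so that [n + 2] exceeds the [1 / (1 - a)] power of [D], contradicting
   [(n + 2) ^ (1 - a) <= D]. *)
pose n := Num.truncn (D `^ (1 - a)^-1).
have n0 : 0 < n.+2%:R :> R by rewrite ltr0n.
have : n.+2%:R `^ (1 - a) <= D.
  have nN0 : n.+2%:R != 0 :> R by rewrite gt_eqF.
  rewrite powRB ?nN0 ?implybT// powRr1 ?ler0n//.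
  rewrite ler_pdivrMr ?powR_gt0// /D -mulrA -powRM ?(ltW rho0) ?ler0n//.
apply/negP; rewrite -ltNge.
have -> : D = (D `^ (1 - a)^-1) `^ (1 - a).
  by rewrite -powRrM mulVf ?powRr1 ?(ltW D0)// gt_eqF// subr_gt0.
rewrite gt0_ltr_powR ?nnegrE ?powR_ge0 ?subr_gt0 ?(ltW n0)//.
by rewrite (lt_trans (truncnS_gt _))// ltr_nat.
Qed.

Theorem corollary1p2 (R : realType) (b : nat) (hb : (2 <= b)%N) :
  assouad_dim (graph01 (@takagi R b)) = (1%R%:E)%E.
Proof.
apply/eqP; rewrite eq_le takagi_assouad_le1//=.
apply: (@assouad_dim_graph_ge1 _ _ 2) => x.
by rewrite takagi_ge0// takagi_le2.
Qed.
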